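(* Let $W$ be a suitable basis of $A$ at $\{\beta_1,\ldots,\beta_I\}$ and let $e\in C[x]$, $M\in C[x]^{r\times r}$ with $SW=\frac1eMW$. Let $h=\frac{cW}{\tilde u}\in A$ with $c=(c_1,\dots,c_r)\in C[x]^r$, $\tilde u\in C[x]$, $\gcd(\tilde u,c_1,\dots,c_r)=1$, and $\tilde u\prod_{i=1}^I(x-\beta_i)$ shift-free. If $h$ is summable in $A$, then $\tilde u$ divides $e$ and $h=\Delta(bW)$ for some $b\in C[x]^r$.
   Context: Let $C$ be a field of characteristic zero and $\bar C$ its algebraic closure; $\sigma(f)(x)=f(x+1)$, $C(x)[S]$ the Ore algebra with $Sf=\sigma(f)S$, $\Delta=S-1$. Fix $L=\sum_{i=0}^r\ell_iS^i\in C[x][S]$ with $\ell_0\ell_r\ne0$ and $A=C(x)[S]/C(x)[S]L$; $f\in A$ is summable if $f=\Delta g$ for some $g\in A$. For a basis $W=(\omega_1,\dots,\omega_r)$, $a\in C[x]^r$, $u\in C[x]$: $\frac{aW}{u}=\frac1u\sum a_i\omega_i$, $SW=(S\omega_i)_i$. A polynomial $p$ is shift-free if $\gcd(p,\sigma^i(p))=1$ for all nonzero $i\in\mathbb Z$. For $\alpha\in\bar C$, operators $P=\sum p_iS^i$ act on $b:\alpha+\mathbb Z\to\bar C((q))$ by $(P\cdot b)(z)=\sum p_i(z+q)b(z+i)$; $\operatorname{Sol}_\alpha(L)=\{b:L\cdot b=0\}$; $\operatorname{val}_\alpha(f)=\min_{b\in\operatorname{Sol}_\alpha(L)}(\nu_q((f\cdot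 b)(\alpha))-\liminf_n\nu_q(b(\alpha-n)))$; $f$ integral at $\alpha$ iff $\operatorname{val}_\alpha(f)\ge0$; a local integral basis at $\alpha$ is a basis of the $C(x)_\alpha$-module of integral elements ($C(x)_\alpha=\{p/q:q(\alpha)\ne0\}$), and at a set if at each point. On $\alpha+\mathbb Z$, $\beta<\gamma$ means $\beta-\gamma$ is a negative integer. Suitable bases: let $\alpha_1+\mathbb Z,\dots,\alpha_I+\mathbb Z$ be the distinct orbits containing a root of $\ell_0\ell_r$; in orbit $i$ let $\alpha_{i,1}<\dots<\alpha_{i,J_i}$ be these roots, and choose $\beta_i\in\alpha_i+\mathbb Z$ with $\alpha_{i,J_i}\le\beta_i$, such that if $\alpha_{i,J_i},\alpha_{i',J_{i'}}$ are $C$-conjugate then $\beta_i-\alpha_{i,J_i}=\beta_{i'}-\alpha_{i',J_{i'}}$. Let $Z=\bigcup_i\{\gamma\in\alpha_i+\mathbb Z\mid\alpha_{i,1}<\gamma\le\beta_i\}$. A $C(x)$-basis $W$ of $A$ is suitable at $\{\beta_1,\dots,\beta_I\}$ if it is a local integral basis at $Z$ and generates the same $C(x)_\alpha$-module as $\{1,S,\dots,S^{r-1}\}$ for every $\alpha\in\bar C\setminus Z$. *)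

(* Defs.v *)
From HB Require Import structures.
From mathcomp Require Import all_boot all_order all_algebra.
Set Implicit Arguments. Unset Strict Implicit. Unset Printing Implicit Defensive.
Import Order.TTheory GRing.Theory Num.Theory.
Local Open Scope ring_scope.
Local Open Scope quotient_scope.

(*  C      : the base field (characteristic zero, hypothesis of the theorem). *)
(*  K      : an algebraically closed field together with an embedding        *)
(*           iota : C -> K such that K is algebraic over C, i.e. K = \bar C. *)
(*  L      = sum_{i<=r} l i S^i, with l : nat -> {poly C}.                   *)
(*  A      = C(x)[S]/C(x)[S]L is modelled as 'rV[{fraction {poly C}}]_r:     *)
(*           the row vector v represents sum_{i<r} v_i S^i (the reduced      *)
(*           representative modulo the left ideal generated by L).           *)
(*  A C(x)-basis W = (w_1..w_r) of A is a matrix 'M_r whose i-th row holds   *)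
(*  the coordinates of w_i; (a W)/u is  u^-1 *: (a *m W).                    *)

Notation tofrac := (@FracField.tofrac _).
Notation "x %:F" := (@FracField.tofrac _ x) (format "x %:F") : ring_scope.

Section Defs.
Variable C : fieldType.

Notation F := {fraction {poly C}}.

Definition shiftp (k : int) (p : {poly C}) : {poly C} := p \Po ('X + (k%:~R)%:P).

Definition sigmaF (f : F) : F :=
  (shiftp 1 \n_(repr f))%:F / (shiftp 1 \d_(repr f))%:F.

Variables (r : nat) (l : nat -> {poly C}).

(* Left multiplication by S on A :
   S (sum_{i<r} v_i S^i) = sum_{i<r} sigma(v_i) S^(i+1), and
   S^r = - sum_{j<r} (l_j / l_r) S^j  in A. *)
Definition shiftA (v : 'rV[F]_r) : 'rV[F]_r :=
  \row_(j < r) (\sum_(i < r | i.+1 == j :> nat) sigmaF (v 0 i)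
                - \sum_(i < r | i.+1 == r) sigmaF (v 0 i) * ((l j)%:F / (l r)%:F)).

Definition deltaA (v : 'rV[F]_r) : 'rV[F]_r := shiftA v - v.

Definition summable (f : 'rV[F]_r) : Prop := exists g : 'rV[F]_r, f = deltaA g.

Definition shiftW (W : 'M[F]_r) : 'M[F]_r := \matrix_(i < r) shiftA (row i W).

Definition shift_free (R : fieldType) (p : {poly R}) : Prop :=
  forall i : int, i != 0 -> coprimep p (p \Po ('X + (i%:~R)%:P)).

Variables (K : closedFieldType) (iota : {rmorphism C -> K}).

(* ---- Laurent series in q over K : maps int -> K with support bounded below *)
Definition is_laurent (a : int -> K) : Prop :=
  exists m : int, forall n : int, n < m -> a n = 0.

Definition pmulL (p : {poly K}) (a : int -> K) : int -> K :=
  fun n => \sum_(j < size p) p`_j * a (n - (j : nat)%:Z).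

(* p(z + q), as a polynomial in q *)
Definition expand (p : {poly C}) (z : K) : {poly K} :=
  (map_poly iota p) \Po ('X + z%:P).

Definition nu_ge (a : int -> K) (m : int) : Prop := forall n : int, n < m -> a n = 0.

(* liminf_{n -> oo} nu_q(s n) >= m  (valuations are in Z u {oo}) *)
Definition liminf_nu_ge (s : nat -> int -> K) (m : int) : Prop :=
  exists N : nat, forall n : nat, (N <= n)%N -> nu_ge (s n) m.

(* Solutions at alpha : b k stands for b(alpha + k), k in Z. *)
Definition is_sol (alpha : K) (b : int -> int -> K) : Prop :=
  (forall k, is_laurent (b k)) /\
  forall (k : int) (n : int),
    \sum_(i < r.+1) pmulL (expand (l i) (alpha + k%:~R)) (b (k + (i : nat)%:Z)) n = 0.

(* y = (f . b)(alpha) = sum_i f_i(alpha + q) b(alpha + i); written with a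
   common denominator f = a/u, y is the unique Laurent series with
   u(alpha+q) y = sum_i a_i(alpha+q) b(alpha+i). *)
Definition act_at (f : 'rV[F]_r) (alpha : K) (b : int -> int -> K) (y : int -> K) : Prop :=
  exists (u : {poly C}) (a : 'rV[{poly C}]_r),
    [/\ u != 0, f = (u%:F)^-1 *: map_mx tofrac a, is_laurent y &
        forall n : int, pmulL (expand u alpha) y n
                = \sum_(i < r) pmulL (expand (a 0 i) alpha) (b (i : nat)%:Z) n].

(* f integral at alpha : val_alpha(f) >= 0, i.e. for every solution b,
   nu_q((f.b)(alpha)) >= liminf_n nu_q(b(alpha - n)). *)
Definition integral_at (f : 'rV[F]_r) (alpha : K) : Prop :=
  forall b, is_sol alpha b -> forall y, act_at f alpha b y ->
  forall m : int, liminf_nu_ge (fun n => b (- (n%:Z))) m -> nu_ge y m.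

Definition loc_ring (alpha : K) (f : F) : Prop :=
  exists p q : {poly C}, (map_poly iota q).[alpha] != 0 /\ f = p%:F / q%:F.

Definition in_loc_span (alpha : K) (W : 'M[F]_r) (f : 'rV[F]_r) : Prop :=
  exists lam : 'rV[F]_r, (forall i, loc_ring alpha (lam 0 i)) /\ f = lam *m W.

Definition local_integral_basis_at (alpha : K) (W : 'M[F]_r) : Prop :=
  [/\ W \in unitmx,
      forall i, integral_at (row i W) alpha &
      forall f, integral_at f alpha -> in_loc_span alpha W f].

Definition same_orbit (a b : K) : Prop := exists k : int, a - b = k%:~R.
Definition lt_orb (a b : K) : Prop := exists k : nat, a - b = - (k.+1)%:R.
Definition le_orb (a b : K) : Prop := a = b \/ lt_orb a b.

Definition is_root0r (a : K) : Prop := root (map_poly iota (l 0%N * l r)) a.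

Definition conjugate (a b : K) : Prop :=
  forall p : {poly C}, root (map_poly iota p) a <-> root (map_poly iota p) b.

Definition max_root_of (beta a : K) : Prop :=
  [/\ is_root0r a, same_orbit a beta &
      forall g, is_root0r g -> same_orbit g beta -> le_orb g a].

Definition admissible_betas (betas : seq K) : Prop :=
  [/\ (forall i j, (i < size betas)%N -> (j < size betas)%N ->
          same_orbit (nth 0 betas i) (nth 0 betas j) -> i = j),
      (forall beta, beta \in betas -> exists a, is_root0r a /\ same_orbit a beta),
      (forall a, is_root0r a -> exists2 beta, beta \in betas & same_orbit a beta),
      (forall beta a, beta \in betas -> is_root0r a -> same_orbit a beta -> le_orb a beta) &
      (forall beta beta' a a', beta \in betas -> beta' \in betas ->
          max_root_of beta a -> max_root_of beta' a' -> conjugate a a' ->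
          beta - a = beta' - a')].

Definition inZ (betas : seq K) (g : K) : Prop :=
  exists2 beta, beta \in betas &
    [/\ same_orbit g beta, le_orb g beta & exists a, is_root0r a /\ lt_orb a g].

Definition suitable (betas : seq K) (W : 'M[F]_r) : Prop :=
  [/\ W \in unitmx,
      forall g, inZ betas g -> local_integral_basis_at g W &
      forall g, ~ inZ betas g ->
        forall f, in_loc_span g 1%:M f <-> in_loc_span g W f].

End Defs.

(* Main.v *)
Require Import Defs.
From HB Require Import structures.
From mathcomp Require Import all_boot all_order all_algebra.
From mathcomp Require Import ring zify.
From Stdlib Require Import Classical ClassicalEpsilon FunctionalExtensionality.
Set Implicit Arguments. Unset Strict Implicit. Unset Printing Implicit Defensive.
Import Order.TTheory GRing.Theory Num.Theory.
Local Open Scope ring_scope.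

(* For each point alpha let Lambda(alpha) be the lattice spanned by W over the
   local ring at alpha. At points alpha <= beta_i of a singular orbit it is the
   module of integral elements: for alpha in Z by hypothesis, and to the left of
   all roots of l_0 l_r because there the values of a solution on any window of
   length r determine its growth at -oo, so that integrality is integrality of the
   coordinates on 1, S, .., S^(r-1). Since (S f . b)(alpha) = (f . b)(alpha + 1),
   S carries integral elements at alpha + 1 onto integral elements at alpha; at
   a point where l_0 l_r does not vanish it also carries the standard lattice onto
   the standard lattice. Hence S f is in Lambda(alpha) if and only if f is in
   Lambda(alpha + 1), except at alpha = beta_i.
   If h = S g - g, then g in Lambda(alpha) is equivalent to g in Lambda(alpha + 1)
   unless alpha is a root of ut * prod (x - beta_i), and shift-freeness leaves at
   most one such alpha in each orbit. As g is in Lambda(alpha) for all but finitely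
   many alpha, propagating from both ends of the orbit shows that g has no pole
   with respect to W. Finally ut * (sigma(b) M - e b) = e c gives ut | e. *)

(** * Rational functions, their shift, and the local rings of C(x) *)

Section Fractions.
Variable C : fieldType.
Notation F := {fraction {poly C}}.
Implicit Types (p q : {poly C}) (f g : F).

Lemma frac_repr f : f = ((repr f).1)%:F / ((repr f).2)%:F.
Proof.
have dN0 : ((repr f).2)%:F != 0 :> F by rewrite tofrac_eq0 denom_ratioP.
apply: (mulIf dN0); rewrite divfK //.
have : \pi_F%qT (repr f) = f by rewrite reprK.
move: (repr f) => x <-.
unlock FracField.tofrac; rewrite -[LHS]FracField.pi_mul; apply/eqmodP.
rewrite /= FracField.equivfE /FracField.mulf.
rewrite !numden_Ratio ?(oner_neq0, mulf_neq0) ?denom_ratioP //.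
by rewrite !mulr1 mulrC.
Qed.

Lemma frac_reprN0 f : (repr f).2 != 0.
Proof. exact: denom_ratioP. Qed.

Lemma eq_frac p q p' q' : q != 0 -> q' != 0 ->
  p%:F / q%:F = p'%:F / q'%:F :> F -> p * q' = p' * q.
Proof.
move=> qN0 q'N0 /eqP; rewrite eqr_div ?tofrac_eq0 // -!tofracM tofrac_eq.
by move/eqP.
Qed.

Lemma coprime_frac f :
  exists p q, [/\ q != 0, coprimep p q & f = p%:F / q%:F].
Proof.
have dN0 := frac_reprN0 f; have fE := frac_repr f.
move: (repr f).1 (repr f).2 dN0 fE => n d dN0 fE.
have gN0 : gcdp n d != 0 by rewrite gcdp_eq0 (negPf dN0) andbF.
exists (n %/ gcdp n d), (d %/ gcdp n d).
have dE := divpK (dvdp_gcdr n d); have nE := divpK (dvdp_gcdl n d).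
split.
- by apply: contra_neq dN0 => d0; rewrite -dE d0 mul0r.
- by rewrite coprimep_div_gcd ?dN0 ?orbT.
have gF : (gcdp n d)%:F != 0 :> F by rewrite tofrac_eq0.
rewrite fE -{1}dE -{1}nE; move: (_ %/ _) (_ %/ _) => n' d'.
by rewrite !tofracM -mulf_div divff ?mulr1.
Qed.

(** Formulated for a multiplicatively closed set [S] of nonzero polynomials so that one argument
    serves both arbitrary denominators and denominators not vanishing at a given point. *)
Lemma common_denominator_in (S : {poly C} -> Prop) (I : finType) (f : I -> F) :
  S 1 -> (forall p q, S p -> S q -> S (p * q)) -> (forall p, S p -> p != 0) ->
  (forall i, exists p q, S q /\ f i = p%:F / q%:F) ->
  exists (u : {poly C}) (a : I -> {poly C}),
    S u /\ forall i, f i = (u%:F)^-1 * (a i)%:F.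
Proof.
move=> S1 SM SN0 /fin_all_exists[n] /fin_all_exists[d] fE.
have Sprod (P : pred I) : S (\prod_(i | P i) d i).
  by apply: big_ind => // i _; case: (fE i).
exists (\prod_i d i), (fun i => n i * \prod_(j | j != i) d j).
split=> // i; rewrite (fE i).2 (bigD1 i) //= !tofracM invfM.
rewrite mulrC -!mulrA; congr (_ * _); rewrite mulrCA mulVf ?mulr1 //.
by rewrite tofrac_eq0 SN0.
Qed.

Lemma common_denominator (I : finType) (f : I -> F) :
  exists (u : {poly C}) (a : I -> {poly C}),
    u != 0 /\ forall i, f i = (u%:F)^-1 * (a i)%:F.
Proof.
apply: (common_denominator_in (S := fun q => q != 0)) => //.
- exact: oner_neq0.
- by move=> p q; apply: mulf_neq0.
by move=> i; exists (repr (f i)).1, (repr (f i)).2; split;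
  [apply: frac_reprN0 | apply: frac_repr].
Qed.

Lemma row_common_denominator r (f : 'rV[F]_r) :
  exists (u : {poly C}) (a : 'rV[{poly C}]_r),
    u != 0 /\ f = (u%:F)^-1 *: map_mx (@tofrac _) a.
Proof.
have [u [a [uN0 fE]]] := common_denominator (fun i => f 0 i).
by exists u, (\row_i a i); split=> //; apply/rowP=> i; rewrite !mxE fE.
Qed.

Lemma shiftpM k p q : shiftp k (p * q) = shiftp k p * shiftp k q.
Proof. exact: comp_polyM. Qed.

Lemma shiftpD k p q : shiftp k (p + q) = shiftp k p + shiftp k q.
Proof. exact: comp_polyD. Qed.

Lemma shiftp_eq0 k p : (shiftp k p == 0) = (p == 0).
Proof. by apply: comp_poly2_eq0; rewrite size_XaddC. Qed.

(** [sigmaF] is defined through a chosen representative; shifting the cross-multiplied polynomial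
    identity shows that any other representative gives the same value. *)
Lemma sigmaF_frac p q : q != 0 ->
  sigmaF (p%:F / q%:F) = (shiftp 1 p)%:F / (shiftp 1 q)%:F.
Proof.
move=> qN0; rewrite /sigmaF; set f := p%:F / q%:F.
have dN0 := frac_reprN0 f; have fE := frac_repr f.
move: (repr f).1 (repr f).2 dN0 fE => n d dN0 fE.
apply/eqP; rewrite eqr_div ?tofrac_eq0 ?shiftp_eq0 // -!tofracM tofrac_eq.
by rewrite -!shiftpM (eq_frac dN0 qN0 (esym fE)).
Qed.

Lemma sigmaF_tofrac p : sigmaF p%:F = (shiftp 1 p)%:F.
Proof.
have := sigmaF_frac p (oner_neq0 {poly C}).
by rewrite /shiftp comp_polyC !tofrac1 !divr1.
Qed.

Lemma sigmaFD f g : sigmaF (f + g) = sigmaF f + sigmaF g.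
Proof.
have dN0 := frac_reprN0 f; have fE := frac_repr f.
have d'N0 := frac_reprN0 g; have gE := frac_repr g.
move: (repr f).1 (repr f).2 (repr g).1 (repr g).2 dN0 fE d'N0 gE.
move=> n d n' d' dN0 -> d'N0 ->.
rewrite addf_div ?tofrac_eq0 // -!tofracM -!tofracD !sigmaF_frac ?mulf_neq0 //.
rewrite addf_div ?tofrac_eq0 ?shiftp_eq0 // -!tofracM -!tofracD.
by rewrite shiftpD !shiftpM.
Qed.

Lemma sigmaFM f g : sigmaF (f * g) = sigmaF f * sigmaF g.
Proof.
have dN0 := frac_reprN0 f; have fE := frac_repr f.
have d'N0 := frac_reprN0 g; have gE := frac_repr g.
move: (repr f).1 (repr f).2 (repr g).1 (repr g).2 dN0 fE d'N0 gE.
move=> n d n' d' dN0 -> d'N0 ->.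
rewrite mulf_div -!tofracM !sigmaF_frac ?mulf_neq0 // mulf_div -!tofracM.
by rewrite !shiftpM.
Qed.

Lemma sigmaF0 : sigmaF (0 : F) = 0.
Proof. by rewrite -tofrac0 sigmaF_tofrac /shiftp comp_poly0. Qed.

Lemma sigmaF_sum (I : finType) (P : pred I) (f : I -> F) :
  sigmaF (\sum_(i | P i) f i) = \sum_(i | P i) sigmaF (f i).
Proof. exact: (big_morph _ sigmaFD sigmaF0). Qed.

(** The coordinates of [shiftA] are linear in the shifted coordinates of its argument, and [sigmaF]
    respects sums and products; hence S acts semilinearly. *)
Lemma shiftA_mul r (l : nat -> {poly C}) (a : 'rV[F]_r) (W : 'M[F]_r) :
  shiftA l (a *m W) = map_mx (@sigmaF C) a *m shiftW l W.
Proof.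
apply/rowP=> j; rewrite !mxE.
under [RHS]eq_bigr => k _ do rewrite !mxE mulrBr !mulr_sumr.
rewrite sumrB; congr (_ - _).
  rewrite exchange_big; apply: eq_bigr => i _ /=.
  by rewrite mxE sigmaF_sum; apply: eq_bigr => k _; rewrite sigmaFM !mxE.
rewrite exchange_big; apply: eq_bigr => i _ /=.
rewrite mxE sigmaF_sum mulr_suml; apply: eq_bigr => k _.
by rewrite sigmaFM !mxE -!mulrA.
Qed.

Variables (K : closedFieldType) (iota : {rmorphism C -> K}).
Implicit Types alpha : K.
Notation ev p alpha := (map_poly iota p).[alpha].

Lemma shiftp_eval p alpha : ev (shiftp 1 p) alpha = ev p (alpha + 1).
Proof.
by rewrite /shiftp map_comp_poly rmorphD /= map_polyX map_polyC /= rmorph1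
  horner_comp !hornerE.
Qed.

Lemma loc_ring_frac alpha p q :
  ev q alpha != 0 -> loc_ring iota alpha (p%:F / q%:F).
Proof. by exists p, q. Qed.

Lemma ev_neq0 alpha q : ev q alpha != 0 -> q != 0.
Proof. by apply: contra_neq => ->; rewrite rmorph0 horner0. Qed.

Lemma loc_ring_tofrac alpha p : loc_ring iota alpha p%:F.
Proof. by exists p, 1; rewrite rmorph1 hornerC oner_neq0 tofrac1 divr1. Qed.

Lemma loc_ring0 alpha : loc_ring iota alpha 0.
Proof. by rewrite -tofrac0; apply: loc_ring_tofrac. Qed.

Lemma loc_ringM alpha f g :
  loc_ring iota alpha f -> loc_ring iota alpha g -> loc_ring iota alpha (f * g).
Proof.
move=> [p [q [qN0 ->]]] [p' [q' [q'N0 ->]]].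
exists (p * p'), (q * q'); rewrite rmorphM hornerM mulf_neq0 //.
by rewrite mulf_div !tofracM.
Qed.

Lemma loc_ringD alpha f g :
  loc_ring iota alpha f -> loc_ring iota alpha g -> loc_ring iota alpha (f + g).
Proof.
move=> [p [q [qN0 ->]]] [p' [q' [q'N0 ->]]].
exists (p * q' + p' * q), (q * q'); rewrite rmorphM hornerM mulf_neq0 //.
by rewrite addf_div ?tofrac_eq0 ?(ev_neq0 qN0) ?(ev_neq0 q'N0) // !(tofracM, tofracD).
Qed.

Lemma loc_ringB alpha f g :
  loc_ring iota alpha f -> loc_ring iota alpha g -> loc_ring iota alpha (f - g).
Proof.
move=> Of Og; apply: loc_ringD => //; rewrite -mulN1r -tofrac1 -tofracN.
exact/loc_ringM/Og/loc_ring_tofrac.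
Qed.

Lemma loc_ring_sum alpha (I : finType) (P : pred I) (f : I -> F) :
  (forall i, P i -> loc_ring iota alpha (f i)) ->
  loc_ring iota alpha (\sum_(i | P i) f i).
Proof.
move=> Of; elim/big_rec: _ => [|i g Pi Og]; first exact: loc_ring0.
by apply: loc_ringD => //; apply: Of.
Qed.

Lemma loc_ring_common_denominator alpha (I : finType) (f : I -> F) :
  (forall i, loc_ring iota alpha (f i)) ->
  exists (u : {poly C}) (a : I -> {poly C}),
    ev u alpha != 0 /\ forall i, f i = (u%:F)^-1 * (a i)%:F.
Proof.
apply: (common_denominator_in (S := fun q => ev q alpha != 0)).
- by rewrite rmorph1 hornerC oner_neq0.
- by move=> p q; rewrite rmorphM hornerM; apply: mulf_neq0.
exact: ev_neq0.
Qed.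

(** By Gauss's lemma the reduced denominator [q] divides every other denominator, so a zero of [q]
    would be a zero of all of them. *)
Lemma loc_ring_coprime alpha p q : q != 0 -> coprimep p q ->
  loc_ring iota alpha (p%:F / q%:F) -> ev q alpha != 0.
Proof.
move=> qN0 cop [p' [q' [q'N0 /(eq_frac qN0 (ev_neq0 q'N0)) E]]].
have /dvdpP[s q'E] : q %| q'.
  have qp : coprimep q p by rewrite coprimep_sym.
  by rewrite -(Gauss_dvdpr _ qp) E dvdp_mulIr.
by apply: contra_neq q'N0 => q0; rewrite q'E rmorphM hornerM q0 mulr0.
Qed.

(** Shifting preserves coprimality, so the reduced denominators to compare are [shiftp 1 q] at
    [alpha] and [q] at [alpha + 1], which have the same value. *)
Lemma loc_ring_sigmaF alpha f :
  loc_ring iota alpha (sigmaF f) <-> loc_ring iota (alpha + 1) f.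
Proof.
have [p [q [qN0 cop ->]]] := coprime_frac f.
rewrite sigmaF_frac //; split=> [O|].
  have copS : coprimep (shiftp 1 p) (shiftp 1 q).
    by apply: coprimep_comp_poly.
  have SqN0 : shiftp 1 q != 0 by rewrite shiftp_eq0.
  by have := loc_ring_coprime SqN0 copS O; rewrite shiftp_eval => ?; exists p, q.
by move/(loc_ring_coprime qN0 cop); rewrite -shiftp_eval; apply: loc_ring_frac.
Qed.

(** A nonconstant reduced denominator would have a root in the algebraically closed field [K]. *)
Lemma loc_ring_everywhere f :
  (forall alpha, loc_ring iota alpha f) -> exists p, f = p%:F.
Proof.
have [p [q [qN0 cop ->]]] := coprime_frac f => Of.
have q1 : size q = 1.
  apply/eqP; rewrite -(size_map_poly iota); apply/negPn/negP => /closed_rootP[a].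
  by rewrite rootE (negPf (loc_ring_coprime qN0 cop (Of a))).
have /size_poly1P[c cN0 ->] : size q == 1 by rewrite q1.
exists (p * (c^-1)%:P); rewrite tofracM; congr (_ * _).
apply: (mulIf (_ : c%:P%:F != 0)); first by rewrite tofrac_eq0 polyC_eq0.
by rewrite mulVf ?tofrac_eq0 ?polyC_eq0 // -tofracM -polyCM mulVf //.
Qed.

End Fractions.

(** * Laurent series as a module over polynomials in q *)

Section Laurent.
Variable K : closedFieldType.
Implicit Types (p q : {poly K}) (y z : int -> K) (m n : int).

Lemma pmulL_widen N p y n : (size p <= N)%N ->
  pmulL p y n = \sum_(j < N) p`_j * y (n - (j : nat)%:Z).
Proof.
move=> leN; rewrite /pmulL (big_ord_widen N (fun j => p`_j * y (n - j%:Z)) leN).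
rewrite big_mkcond; apply: eq_bigr => j _; case: ltnP => // le_j.
by rewrite nth_default ?mul0r.
Qed.

Lemma pmulLDl p q y n : pmulL (p + q) y n = pmulL p y n + pmulL q y n.
Proof.
pose N := maxn (size p) (size q).
rewrite !(@pmulL_widen N) ?leq_maxl ?leq_maxr ?size_polyD // -big_split.
by apply: eq_bigr => j _; rewrite coefD mulrDl.
Qed.

Lemma pmulLZl c p y n : pmulL (c *: p) y n = c * pmulL p y n.
Proof.
rewrite (@pmulL_widen (size p)) ?size_scale_leq // mulr_sumr.
by apply: eq_bigr => j _; rewrite coefZ mulrA.
Qed.

Lemma pmulLNl p y n : pmulL (- p) y n = - pmulL p y n.
Proof. by rewrite -scaleN1r pmulLZl mulN1r. Qed.

Lemma pmulLC c y n : pmulL c%:P y n = c * y n.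
Proof.
by rewrite (@pmulL_widen 1) ?size_polyC ?leq_b1 // big_ord1 coefC subr0.
Qed.

Lemma pmulLMX p y n : pmulL (p * 'X) y n = pmulL p y (n - 1).
Proof.
rewrite (@pmulL_widen (size p).+1).
  rewrite big_ord_recl coefMX mul0r add0r; apply: eq_bigr => j _.
  by rewrite coefMX /= /bump /= add1n /=; congr (_ * y _); lia.
by apply: (leq_trans (size_polyMleq _ _)); rewrite size_polyX addn2.
Qed.

Lemma pmulL_sumr (I : finType) (P : pred I) p (Y : I -> int -> K) n :
  pmulL p (fun n => \sum_(i | P i) Y i n) n = \sum_(i | P i) pmulL p (Y i) n.
Proof.
by rewrite /pmulL exchange_big; apply: eq_bigr => j _; rewrite mulr_sumr.
Qed.

Lemma pmulL_suml (I : finType) (P : pred I) (p : I -> {poly K}) y n :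
  pmulL (\sum_(i | P i) p i) y n = \sum_(i | P i) pmulL (p i) y n.
Proof.
apply: (big_morph (fun p => pmulL p y n)) => [p1 p2|].
  exact: pmulLDl.
by rewrite -polyC0 pmulLC mul0r.
Qed.

Lemma pmulLBr p y z n :
  pmulL p (fun n => y n - z n) n = pmulL p y n - pmulL p z n.
Proof. by rewrite /pmulL -sumrB; apply: eq_bigr => j _; rewrite mulrBr. Qed.

Lemma pmulLNr p y n : pmulL p (fun n => - y n) n = - pmulL p y n.
Proof. by rewrite /pmulL -sumrN; apply: eq_bigr => j _; rewrite mulrN. Qed.

Lemma eq_pmulL p y z : y =1 z -> pmulL p y =1 pmulL p z.
Proof. by move=> yz n; apply: eq_bigr => j _; rewrite yz. Qed.

Lemma pmulLA p q y n : pmulL (p * q) y n = pmulL p (pmulL q y) n.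
Proof.
elim/poly_ind: p n => [|p c IH] n; first by rewrite mul0r -polyC0 !pmulLC !mul0r.
rewrite mulrDl !pmulLDl pmulLC mulrAC !pmulLMX IH; congr (_ + _).
by rewrite mul_polyC pmulLZl.
Qed.

Lemma pmulL_nu_ge p y m : nu_ge y m -> nu_ge (pmulL p y) m.
Proof.
by move=> ym n ltn; rewrite /pmulL big1 // => j _; rewrite ym ?mulr0 //; lia.
Qed.

Lemma is_laurent_pmulL p y : is_laurent y -> is_laurent (pmulL p y).
Proof. by move=> [m ym]; exists m; apply: pmulL_nu_ge. Qed.

Lemma is_laurent_sub y z :
  is_laurent y -> is_laurent z -> is_laurent (fun n => y n - z n).
Proof.
move=> [m ym] [m' zm']; exists (Num.min m m') => n; rewrite lt_min => /andP[nm nm'].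
by rewrite ym // zm' // subr0.
Qed.

Lemma is_laurent_opp y : is_laurent y -> is_laurent (fun n => - y n).
Proof. by move=> [m ym]; exists m => n nm; rewrite ym ?oppr0. Qed.

Lemma is_laurent_sum (I : finType) (P : pred I) (Y : I -> int -> K) :
  (forall i, P i -> is_laurent (Y i)) ->
  is_laurent (fun n => \sum_(i | P i) Y i n).
Proof.
move=> YL; elim: (index_enum I) => [|i s [m IH]].
  by exists 0 => n _; rewrite big_nil.
case Pi: (P i); last by exists m => n nm; rewrite big_cons Pi IH.
have [m' Ym'] := YL i Pi; exists (Num.min m m') => n.
by rewrite lt_min big_cons Pi => /andP[nm nm']; rewrite Ym' // IH // addr0.
Qed.

Lemma nu_ge_sum (I : finType) (P : pred I) (Y : I -> int -> K) m :
  (forall i, P i -> nu_ge (Y i) m) -> nu_ge (fun n => \sum_(i | P i) Y i n) m.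
Proof. by move=> Ym n nm; apply: big1 => i Pi; apply: Ym. Qed.

(** A polynomial with nonzero constant term is a unit among power series, so it preserves
    valuations. The induction on [k] pushes the initial bound [m'] up to [m], one coefficient at a
    time. *)
Lemma nu_ge_pmulL_unit p y m : p.[0] != 0 -> is_laurent y ->
  nu_ge (pmulL p y) m -> nu_ge y m.
Proof.
rewrite horner_coef0 => p0 [m' ym'] pym.
suff H k : nu_ge y (Num.min m (m' + k%:Z)).
  by move=> n nm; apply: (H `|n - m'|.+1); rewrite lt_min nm; lia.
elim: k => [|k IH] n; rewrite lt_min => /andP[nm nk].
  by apply: ym'; lia.
have [] := ltrP n (m' + k%:Z); first by move=> nk'; apply: IH; rewrite lt_min nm.
move=> nk'; have := pym n nm.
rewrite (@pmulL_widen (size p).+1) // big_ord_recl subr0 big1 => [|j _].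
  by rewrite addr0 => /eqP; rewrite mulf_eq0 (negPf p0) => /eqP.
by rewrite IH ?mulr0 // lt_min /= /bump /=; lia.
Qed.

Lemma poly_XnM_unit p : p != 0 -> exists v w, w.[0] != 0 /\ p = w * 'X^v.
Proof.
move=> pN0; have [v [w]] := multiplicity_XsubC p 0.
rewrite pN0 subr0 /= => w0 pE; exists v, w; split=> //.
Qed.

Lemma pmulLMXn p v y n : pmulL (p * 'X^v) y n = pmulL p y (n - v%:Z).
Proof.
elim: v n => [|v IH] n; first by rewrite expr0 mulr1 subr0.
by rewrite exprSr mulrA pmulLMX IH; congr (pmulL _ _ _); lia.
Qed.

(** Once the power of q in [p] is split off as an index shift, the remaining factor is a unit. *)
Lemma pmulL_eq0 p y : p != 0 -> is_laurent y -> pmulL p y =1 (fun=> 0) ->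
  y =1 (fun=> 0).
Proof.
move=> /poly_XnM_unit[v [w [w0 ->]]] yL py0 n.
apply: (nu_ge_pmulL_unit (m := n + 1) w0 yL) => [k _|]; last by lia.
by have := py0 (k + v%:Z); rewrite pmulLMXn addrK.
Qed.

Lemma pmulL_inj p y z : p != 0 -> is_laurent y -> is_laurent z ->
  pmulL p y =1 pmulL p z -> y =1 z.
Proof.
move=> pN0 yL zL E n; apply/eqP; rewrite -subr_eq0; apply/eqP.
apply: (pmulL_eq0 pN0 (is_laurent_sub yL zL)) => k.
by rewrite pmulLBr E subrr.
Qed.

Lemma pmulL_XsubC_surj (x : K) z : is_laurent z ->
  exists2 y, is_laurent y & pmulL ('X - x%:P) y =1 z.
Proof.
move=> [m zm].
have E y n : pmulL ('X - x%:P) y n = y (n - 1) - x * y n.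
  by rewrite pmulLDl -polyCN pmulLC -['X]mul1r pmulLMX -polyC1 pmulLC mul1r mulNr.
have [->|xN0] := eqVneq x 0.
  exists (fun n => z (n + 1)); first by exists (m - 1) => n nm; apply: zm; lia.
  by move=> n; rewrite subr0 -['X]mul1r pmulLMX -polyC1 pmulLC mul1r subrK.
(* [c k] is the coefficient at [m + k]: the equation y (n - 1) - x * y n = z n is solved for y n,
   starting from zero below [m]. *)
pose c := nat_rect (fun=> K) (- z m / x) (fun k ck => (ck - z (m + k.+1%:Z)) / x).
pose y n := if n < m then 0 else c `|n - m|%N.
exists y => [|n]; first by exists m => n nm; rewrite /y nm.
rewrite E /y; case: (ltrP n m) => nm.
  by rewrite (_ : n - 1 < m) ?zm ?mulr0 ?subr0 //; lia.
have [k nE] : exists k : nat, n = m + k%:Z by exists `|n - m|%N; lia.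
rewrite nE; case: k nE => [|k] nE.
  rewrite (_ : m + 0%:Z - 1 < m); last by lia.
  by rewrite addr0 subrr /= mulrCA divff // mulr1 sub0r opprK.
rewrite (_ : m + k.+1%:Z - 1 < m = false); last by apply/negP; lia.
have -> : absz (m + k.+1%:Z - m)%R = k.+1 by lia.
have -> : absz (m + k.+1%:Z - 1 - m)%R = k by lia.
by rewrite /= mulrCA divff // mulr1 subKr.
Qed.

(** [p] splits into linear factors over [K], and these are divided out one by one. *)
Lemma pmulL_surj p z : p != 0 -> is_laurent z ->
  exists2 y, is_laurent y & pmulL p y =1 z.
Proof.
have [s ->] := closed_field_poly_normal p.
rewrite scaler_eq0 lead_coef_eq0 => /norP[pN0 _].
elim: s z => [|x s IH] z zL.
  rewrite big_nil; exists (fun n => (lead_coef p)^-1 * z n).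
    by case: zL => m zm; exists m => n nm; rewrite zm ?mulr0.
  by move=> n; rewrite pmulLZl -polyC1 pmulLC mul1r mulVKf ?lead_coef_eq0.
have [y yL yz] := pmulL_XsubC_surj x zL; have [w wL wy] := IH y yL.
exists w => // n; rewrite big_cons scalerAr pmulLA -yz; exact: eq_pmulL.
Qed.

(** Chosen by [epsilon] to make division a total function that can occur inside recursions; it is
    meaningful for [p] nonzero and [z] a Laurent series. *)
Definition divL p z : int -> K :=
  epsilon (inhabits z) (fun y => is_laurent y /\ pmulL p y =1 z).

Lemma divLP p z : p != 0 -> is_laurent z ->
  is_laurent (divL p z) /\ pmulL p (divL p z) =1 z.
Proof.
move=> pN0 zL.
apply: (epsilon_spec (inhabits z) (fun y => is_laurent y /\ pmulL p y =1 z)).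
by have [y yL yz] := pmulL_surj pN0 zL; exists y.
Qed.

End Laurent.

(** Course-of-values recursion: iterating [G] from a constant sequence fixes entry [n] after [n.+1]
    rounds, and the solution is read off along this diagonal. *)
Lemma strong_recursion T (G : nat -> (nat -> T) -> T) : inhabited T ->
  (forall n b b', (forall k, (k < n)%N -> b k = b' k) -> G n b = G n b') ->
  exists b, forall n, b n = G n b.
Proof.
move=> [t0] Gext; pose it k := iter k (fun b n => G n b) (fun=> t0).
have itE k : forall k' n, (n < k)%N -> (n < k')%N -> it k n = it k' n.
  elim: k => [//|k IH] [//|k'] n nk nk' /=; apply: Gext => i ik.
  by apply: IH; lia.
exists (fun n => it n.+1 n) => n; rewrite {1}/it iterS; apply: Gext => k kn.
exact: itE.
Qed.

(** * Action on solutions and its compatibility with the shift *)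

Section Integrality.
Variables (C : fieldType) (K : closedFieldType) (iota : {rmorphism C -> K}).
Notation F := {fraction {poly C}}.
Notation ev p alpha := (map_poly iota p).[alpha].
Implicit Types (p q u : {poly C}) (alpha z : K).

Lemma expandM p q z : expand iota (p * q) z = expand iota p z * expand iota q z.
Proof. by rewrite /expand rmorphM comp_polyM. Qed.

Lemma expandB p q z : expand iota (p - q) z = expand iota p z - expand iota q z.
Proof. by rewrite /expand rmorphB comp_polyB. Qed.

Lemma expand_sum (I : finType) (P : pred I) (p : I -> {poly C}) z :
  expand iota (\sum_(i | P i) p i) z = \sum_(i | P i) expand iota (p i) z.
Proof. by rewrite /expand !rmorph_sum. Qed.

Lemma expand_eq0 p z : (expand iota p z == 0) = (p == 0).
Proof. by rewrite comp_poly2_eq0 ?size_XaddC // map_poly_eq0. Qed.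

Lemma expand0 p z : (expand iota p z).[0] = ev p z.
Proof. by rewrite horner_comp !hornerE. Qed.

Lemma expand_shiftp p z : expand iota (shiftp 1 p) z = expand iota p (z + 1).
Proof.
rewrite /expand /shiftp map_comp_poly rmorphD /= map_polyX map_polyC /= rmorph1.
by rewrite -comp_polyA comp_polyD comp_polyX comp_polyC -addrA -polyCD.
Qed.

Variables (r : nat) (l : nat -> {poly C}).
Implicit Types (a : 'rV[{poly C}]_r) (b : int -> int -> K) (f : 'rV[F]_r).

(** Numerator of the action: for f = a/u, the series (f . b)(alpha) is this one divided by
    [expand iota u alpha]. *)
Definition actL a alpha b (n : int) : K :=
  \sum_(i < r) pmulL (expand iota (a 0 i) alpha) (b (i : nat)%:Z) n.

Lemma is_laurent_actL a alpha b :
  is_sol r l iota alpha b -> is_laurent (actL a alpha b).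
Proof. by move=> [bL _]; apply: is_laurent_sum => i _; apply: is_laurent_pmulL. Qed.

Lemma pmulL_actL p a alpha b n :
  pmulL (expand iota p alpha) (actL a alpha b) n = actL (p *: a) alpha b n.
Proof.
by rewrite pmulL_sumr; apply: eq_bigr => i _; rewrite -pmulLA -expandM mxE.
Qed.

(** [act_at] allows every representation of f as a fraction. Cross-multiplying two of them and using
    that Laurent series have no torsion shows that a fixed one suffices. *)
Lemma integral_atP u a alpha : u != 0 ->
  integral_at l iota ((u%:F)^-1 *: map_mx (@tofrac _) a) alpha <->
  (forall b, is_sol r l iota alpha b -> forall y, is_laurent y ->
   pmulL (expand iota u alpha) y =1 actL a alpha b ->
   forall m, liminf_nu_ge (fun n => b (- n%:Z)) m -> nu_ge y m).
Proof.
move=> uN0; split=> intf b bsol y; first by move=> yL E; apply: intf => //; exists u, a.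
move=> [u' [a' [u'N0 aE yL E]]]; apply: (intf b bsol y yL).
apply: (@pmulL_inj _ (expand iota u' alpha)); rewrite ?expand_eq0 //.
- exact: is_laurent_pmulL.
- exact: is_laurent_actL.
move=> n; rewrite -pmulLA mulrC pmulLA (eq_pmulL _ E) !pmulL_actL.
congr (actL _ _ _ _); apply/rowP=> i; rewrite !mxE [RHS]mulrC [LHS]mulrC.
move/rowP: aE => /(_ i); rewrite !mxE ![_^-1 * _]mulrC.
by move/(eq_frac uN0 u'N0).
Qed.

Lemma is_sol_shift alpha b :
  is_sol r l iota alpha b <-> is_sol r l iota (alpha + 1) (fun k => b (k + 1)).
Proof.
split=> [] [bL Eb]; split=> k; first exact: bL.
- move=> n; rewrite -[RHS](Eb (k + 1) n); apply: eq_bigr => i _.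
  rewrite rmorphD /= -addrA [1 + _]addrC; congr (pmulL _ (b _) _); lia.
- by have := bL (k - 1); rewrite subrK.
move=> n; rewrite -[RHS](Eb (k - 1) n); apply: eq_bigr => i _.
rewrite rmorphB /= (_ : alpha + 1 + (k%:~R - 1) = alpha + k%:~R).
  congr (pmulL _ (b _) _); lia.
by rewrite -addrA [1 + _]addrC subrK.
Qed.

Lemma liminf_nu_ge_shift (b : int -> int -> K) m :
  liminf_nu_ge (fun n => b (- n%:Z)) m <->
  liminf_nu_ge (fun n => b (- n%:Z + 1)) m.
Proof.
split=> [] [N bN].
  exists N.+1 => [] [//|n] nN; have := bN n nN.
  by rewrite (_ : - n.+1%:Z + 1 = - n%:Z) //; lia.
exists N => n nN; have := bN n.+1 (leqW nN).
by rewrite (_ : - n.+1%:Z + 1 = - n%:Z) //; lia.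
Qed.

(** Numerators of S (a/u) over the denominator [l r * shiftp 1 u]; the second sum comes from
    reducing S^r modulo L. *)
Definition shift_num a : 'rV[{poly C}]_r :=
  \row_(j < r) (\sum_(i < r | i.+1 == j :> nat) l r * shiftp 1 (a 0 i)
                - \sum_(i < r | i.+1 == r) shiftp 1 (a 0 i) * l j).

Lemma shiftA_num u a : u != 0 -> l r != 0 ->
  shiftA l ((u%:F)^-1 *: map_mx (@tofrac _) a) =
  ((l r * shiftp 1 u)%:F)^-1 *: map_mx (@tofrac _) (shift_num a).
Proof.
move=> uN0 lrN0; apply/rowP=> j; rewrite !mxE rmorphB /= !rmorph_sum mulrBr.
have lrF : (l r)%:F != 0 :> F by rewrite tofrac_eq0.
have suF : (shiftp 1 u)%:F != 0 :> F by rewrite tofrac_eq0 shiftp_eq0.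
have sE i : sigmaF (((u%:F)^-1 *: map_mx (@tofrac _) a) 0 i) =
    (shiftp 1 (a 0 i))%:F / (shiftp 1 u)%:F.
  by rewrite !mxE mulrC sigmaF_frac.
have aux1 (G : fieldType) (L s x : G) : L != 0 -> x / s = (L * s)^-1 * (L * x).
  by move=> L0; rewrite invfM mulrACA mulVf // mul1r mulrC.
have aux2 (G : fieldType) (L s x y : G) : x / s * (y / L) = (L * s)^-1 * (x * y).
  by rewrite mulf_div mulrC [s * L]mulrC.
congr (_ - _); rewrite mulr_sumr; apply: eq_bigr => i _; rewrite sE /= !tofracM.
  by rewrite (aux1 _ (l r)%:F _ _ lrF); congr (_ * _).
by rewrite aux2; congr (_ * _).
Qed.

(** This is (S f . b)(alpha) = (f . b)(alpha + 1) with denominators cleared. The recurrence for [b]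
    at [alpha] replaces b(alpha + r) by lower terms exactly as reduction modulo L replaces S^r. *)
Lemma actL_shift_num a alpha b : is_sol r l iota alpha b ->
  actL (shift_num a) alpha b =1
  pmulL (expand iota (l r) alpha) (actL a (alpha + 1) (fun k => b (k + 1))).
Proof.
move=> [bL Eb] n; rewrite pmulL_sumr.
pose P (i : 'I_r) := expand iota (shiftp 1 (a 0 i)) alpha.
pose Q i := expand iota (l i) alpha.
transitivity (\sum_(i < r) pmulL (Q r * P i) (b i.+1%:Z) n); last first.
  apply: eq_bigr => i _; rewrite pmulLA /P expand_shiftp.
  by apply: eq_pmulL => k; apply: eq_pmulL => k'; congr (b _ _); lia.
have br : pmulL (Q r) (b r%:Z) =1
    fun n => - \sum_(j < r) pmulL (Q j) (b (j : nat)%:Z) n.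
  move=> k; apply/eqP; rewrite -addr_eq0 addrC.
  have := Eb 0 k; rewrite big_ord_recr /= addr0 add0r => E.
  by rewrite -[X in _ == X]E; apply/eqP; congr (_ + _); apply: eq_bigr => j _; rewrite add0r.
transitivity (\sum_(j < r) (\sum_(i < r | i.+1 == j :> nat) pmulL (Q r * P i) (b j%:Z) n
    - \sum_(i < r | i.+1 == r) pmulL (P i) (pmulL (Q j) (b j%:Z)) n)).
  apply: eq_bigr => j _; rewrite mxE expandB pmulLDl pmulLNl !expand_sum !pmulL_suml.
  congr (_ - _); apply: eq_bigr => i _; first by rewrite expandM.
  by rewrite expandM pmulLA.
rewrite sumrB (exchange_big_dep xpredT) //= [X in _ - X]exchange_big /=.
under [X in _ - X]eq_bigr => i _ do
  rewrite -(pmulL_sumr xpredT (P i) (fun j : 'I_r => pmulL (Q j) (b (j : nat)%:Z))).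
rewrite [X in _ - X]big_mkcond -sumrB; apply: eq_bigr => i _.
(* Only the last coordinate meets the reduction modulo L; for every other [i] the first sum leaves
   the single term [j = i.+1]. *)
have [ir|ir] := eqVneq i.+1 r.
  rewrite big_pred0 => [|j]; last by apply/negbTE; rewrite ir neq_ltn ltn_ord orbT.
  rewrite sub0r -pmulLNr mulrC pmulLA ir; apply: eq_pmulL => k.
  by rewrite br.
have lt_ir : (i.+1 < r)%N by rewrite ltn_neqAle ir ltn_ord.
by rewrite subr0 (big_pred1 (Ordinal lt_ir)) // => j; rewrite -val_eqE /= eq_sym.
Qed.

(** Solutions at [alpha] and at [alpha + 1] are the same functions re-indexed, with the same growth
    at minus infinity. *)
Lemma integral_at_shiftA f alpha : l r != 0 ->
  integral_at l iota (shiftA l f) alpha <-> integral_at l iota f (alpha + 1).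
Proof.
move=> lrN0; have [u [a [uN0 ->]]] := row_common_denominator f.
rewrite shiftA_num // !integral_atP ?mulf_neq0 ?shiftp_eq0 //.
have eqE b y : is_sol r l iota alpha b -> is_laurent y ->
    pmulL (expand iota (l r * shiftp 1 u) alpha) y =1 actL (shift_num a) alpha b <->
    pmulL (expand iota u (alpha + 1)) y =1 actL a (alpha + 1) (fun k => b (k + 1)).
  move=> bsol yL; split=> E.
    apply: (@pmulL_inj _ (expand iota (l r) alpha)); rewrite ?expand_eq0 //.
    - exact: is_laurent_pmulL.
    - exact: is_laurent_actL ((is_sol_shift _ _).1 bsol).
    by move=> n; rewrite -expand_shiftp -pmulLA -expandM E actL_shift_num.
  by move=> n; rewrite expandM pmulLA expand_shiftp (eq_pmulL _ E) actL_shift_num.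
split=> H b bsol y yL E m mb.
  pose b' k := b (k - 1).
  have b'E : (fun k => b' (k + 1)) = b.
    by apply: functional_extensionality => k; rewrite /b' addrK.
  have b'sol : is_sol r l iota alpha b' by apply/is_sol_shift; rewrite b'E.
  apply: (H b' b'sol y yL); first by apply/eqE => //; rewrite b'E.
  apply/liminf_nu_ge_shift; move: mb; congr liminf_nu_ge.
  by apply: functional_extensionality => n; rewrite -[in LHS]b'E.
apply: (H (fun k => b (k + 1)) ((is_sol_shift _ _).1 bsol) y yL).
  exact/eqE.
exact/(liminf_nu_ge_shift b m).
Qed.

End Integrality.

(** * Integral elements and the standard lattice *)

Section IntegralModule.
Variables (C : fieldType) (K : closedFieldType) (iota : {rmorphism C -> K}).
Notation F := {fraction {poly C}}.
Notation ev p alpha := (map_poly iota p).[alpha].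
Variables (r : nat) (l : nat -> {poly C}).
Implicit Types (a : 'rV[{poly C}]_r) (b : int -> int -> K) (f : 'rV[F]_r).
Implicit Types (W : 'M[F]_r) (alpha : K).

Lemma in_loc_span_unitmx alpha W f : W \in unitmx ->
  in_loc_span iota alpha W f <-> forall i, loc_ring iota alpha ((f *m invmx W) 0 i).
Proof.
move=> uW; split=> [[lam [Olam ->]]|Of]; first by rewrite mulmxK.
by exists (f *m invmx W); rewrite mulmxKV.
Qed.

Lemma in_loc_span1 alpha f :
  in_loc_span iota alpha 1%:M f <-> forall i, loc_ring iota alpha (f 0 i).
Proof. by rewrite in_loc_span_unitmx ?unitmx1 // invmx1 mulmx1. Qed.

Lemma integral_at_span alpha W f :
  (forall i, integral_at l iota (row i W) alpha) -> in_loc_span iota alpha W f ->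
  integral_at l iota f alpha.
Proof.
move=> intW [lam [Olam ->]].
have [q [p [qN0 lamE]]] := loc_ring_common_denominator Olam.
have [u [B [uN0 WE]]] := common_denominator (fun ij : 'I_r * 'I_r => W ij.1 ij.2).
pose a : 'rV[{poly C}]_r := \row_j \sum_i p i * B (i, j).
have fE : lam *m W = ((q * u)%:F)^-1 *: map_mx (@tofrac _) a.
  apply/rowP=> j; rewrite !mxE rmorph_sum mulr_sumr; apply: eq_bigr => i _.
  by rewrite lamE (WE (i, j)) tofracM invfM rmorphM /= mulrACA.
pose Bi i : 'rV[{poly C}]_r := \row_j B (i, j).
have WiE i : row i W = (u%:F)^-1 *: map_mx (@tofrac _) (Bi i).
  by apply/rowP=> j; rewrite !mxE (WE (i, j)).
rewrite fE; apply/integral_atP; first by rewrite mulf_neq0 ?(ev_neq0 qN0).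
move=> b bsol y yL E m mb.
have uE : expand iota u alpha != 0 by rewrite expand_eq0.
pose Y i := divL (expand iota u alpha) (actL iota (Bi i) alpha b).
have YP i : is_laurent (Y i) /\
    pmulL (expand iota u alpha) (Y i) =1 actL iota (Bi i) alpha b.
  by apply: divLP => //; apply: (is_laurent_actL _ bsol).
have Ym i : nu_ge (Y i) m.
  have [YL YE] := YP i; have := intW i; rewrite WiE integral_atP //.
  by move/(_ b bsol (Y i) YL YE m mb).
(* The common denominator [q] of the coefficients does not vanish at [alpha], so its expansion is a
   unit and a bound on this product bounds [y]. *)
have qy : pmulL (expand iota q alpha) y =1
    fun n => \sum_i pmulL (expand iota (p i) alpha) (Y i) n.
  apply: (pmulL_inj uE); first exact: is_laurent_pmulL.
    by apply: is_laurent_sum => i _; apply: is_laurent_pmulL; case: (YP i).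
  move=> n; rewrite -pmulLA mulrC -expandM E pmulL_sumr.
  under [RHS]eq_bigr => i _ do
    rewrite -pmulLA mulrC pmulLA (eq_pmulL _ (YP i).2) pmulL_actL.
  rewrite exchange_big; apply: eq_bigr => j _.
  rewrite mxE expand_sum pmulL_suml; apply: eq_bigr => i _.
  by rewrite !mxE.
apply: (@nu_ge_pmulL_unit _ (expand iota q alpha)) => //; first by rewrite expand0.
move=> n nm; rewrite qy; move: n nm.
by apply: nu_ge_sum => i _; apply: pmulL_nu_ge.
Qed.

(** Where [l i0] does not vanish its expansion is a unit, so the recurrence expresses that term
    through the others without loss of valuation. *)
Lemma sol_window_nu_ge alpha b (k m : int) (i0 : nat) :
  is_sol r l iota alpha b -> (i0 <= r)%N -> ev (l i0) (alpha + k%:~R) != 0 ->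
  (forall i, (i <= r)%N -> i != i0 -> nu_ge (b (k + i%:Z)) m) ->
  nu_ge (b (k + i0%:Z)) m.
Proof.
move=> [bL Eb] i0r li0 bm; rewrite -expand0 in li0.
apply: (nu_ge_pmulL_unit li0) => // n nm; have := Eb k n.
rewrite (bigD1 (Ordinal (i0r : (i0 < r.+1)%N))) //= big1 ?addr0 // => i ii0.
by apply: (@pmulL_nu_ge _ _ _ m) => //; apply: bm => //; rewrite -ltnS.
Qed.

(** Descends along the orbit, solving the recurrence for its lowest term. The index [r - 1 - n]
    starts at the top of the initial window. *)
Lemma sol_nu_ge_left alpha b m : is_sol r l iota alpha b ->
  (forall k : nat, ev (l 0%N) (alpha - k.+1%:R) != 0) ->
  (forall i, (i < r)%N -> nu_ge (b i%:Z) m) ->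
  forall n : nat, nu_ge (b (r%:Z - 1 - n%:Z)) m.
Proof.
move=> bsol l0 binit n; elim/ltn_ind: n => n IH; have [nr|rn] := ltnP n r.
  have -> : r%:Z - 1 - n%:Z = (r.-1 - n)%N by lia.
  by apply: binit; lia.
have := @sol_window_nu_ge alpha b (r%:Z - 1 - n%:Z) m 0 bsol isT.
rewrite addr0; apply.
  have -> : r%:Z - 1 - n%:Z = - (n - r)%N.+1%:Z by lia.
  by rewrite rmorphN l0.
move=> i ir i0; 
have -> : r%:Z - 1 - n%:Z + i%:Z = r%:Z - 1 - (n - i)%N%:Z by lia.
by apply: IH; lia.
Qed.

(** Climbs from the far left, where the liminf gives the bound, solving the recurrence for its top
    term; all base points used lie strictly left of [alpha]. *)
Lemma sol_nu_ge_right alpha b m : is_sol r l iota alpha b ->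
  (forall k : nat, ev (l r) (alpha - k.+1%:R) != 0) ->
  liminf_nu_ge (fun n => b (- n%:Z)) m ->
  forall i, (i < r)%N -> nu_ge (b i%:Z) m.
Proof.
move=> bsol lr [N bN] i ir.
suff H t : (t < N + r)%N -> nu_ge (b (t%:Z - N%:Z)) m.
  by have := H (N + i)%N; rewrite ltn_add2l PoszD addrAC subrr add0r; apply.
elim/ltn_ind: t => t IH tNr.
have := @sol_window_nu_ge alpha b (t%:Z - N%:Z - r%:Z) m r bsol (leqnn r).
rewrite subrK; apply.
  have -> : t%:Z - N%:Z - r%:Z = - (N + r - t).-1.+1%:Z by lia.
  by rewrite rmorphN lr.
move=> j jr jNr; have [le_rtj|lt_tjr] := leqP r (t + j).
  have -> : t%:Z - N%:Z - r%:Z + j%:Z = (t + j - r)%N%:Z - N%:Z by lia.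
  by apply: IH; lia.
have -> : t%:Z - N%:Z - r%:Z + j%:Z = - (N + r - t - j)%N%:Z by lia.
by apply: bN; lia.
Qed.

(** Solved to the right by dividing by [l r] and to the left by dividing by [l 0]. Their expansions
    in q are nonzero even at their zeros, so no point of the orbit is an obstacle. *)
Lemma sol_exists alpha (init : nat -> int -> K) :
  l 0%N != 0 -> l r != 0 -> (forall i, is_laurent (init i)) ->
  exists2 b, is_sol r l iota alpha b & forall i, (i < r)%N -> b i%:Z = init i.
Proof.
move=> l0 lr initL.
pose ex i (k : int) := expand iota (l i) (alpha + k%:~R).
have exN0 i k : l i != 0 -> ex i k != 0 by rewrite expand_eq0.
pose GR n (b : nat -> int -> K) := if (n < r)%N then init n else
  divL (ex r (n - r)%N)
    (fun m => - \sum_(i < r) pmulL (ex i (n - r)%N) (b (n - r + i)%N) m).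
(* The leftward sequence is indexed so that term n is the value at r - 1 - n. *)
pose GL n (b : nat -> int -> K) := if (n < r)%N then init (r.-1 - n)%N else
  divL (ex 0%N (r%:Z - 1 - n%:Z))
    (fun m => - \sum_(i < r) pmulL (ex i.+1 (r%:Z - 1 - n%:Z)) (b (n - i.+1)%N) m).
have [bR bRE] : exists s : nat -> int -> K, forall n, s n = GR n s.
  apply: strong_recursion; first exact: inhabits (init 0%N).
  move=> n b b' bb'; rewrite /GR; case: ltnP => // rn; congr divL.
  apply: functional_extensionality => m; congr (- _); apply: eq_bigr => i _.
  by rewrite bb' //; have := ltn_ord i; lia.
have [bL bLE] : exists s : nat -> int -> K, forall n, s n = GL n s.
  apply: strong_recursion; first exact: inhabits (init 0%N).
  move=> n b b' bb'; rewrite /GL; case: ltnP => // rn; congr divL.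
  apply: functional_extensionality => m; congr (- _); apply: eq_bigr => i _.
  by rewrite bb' //; have := ltn_ord i; lia.
have bRL n : is_laurent (bR n).
  elim/ltn_ind: n => n IH; rewrite bRE /GR; case: ltnP => // rn.
  apply: (divLP _ _).1; first exact: exN0.
  apply/is_laurent_opp/is_laurent_sum => i _; apply/is_laurent_pmulL/IH.
  by have := ltn_ord i; lia.
have bLL n : is_laurent (bL n).
  elim/ltn_ind: n => n IH; rewrite bLE /GL; case: ltnP => // rn.
  apply: (divLP _ _).1; first exact: exN0.
  apply/is_laurent_opp/is_laurent_sum => i _; apply/is_laurent_pmulL/IH.
  by have := ltn_ord i; lia.
(* [Negz n] is the index - n - 1, which is term [n + r] of the leftward sequence; both sequences
   agree on the initial window. *)
pose b k := match k with Posz n => bR n | Negz n => bL (n + r)%N end.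
have b_init i : (i < r)%N -> b i%:Z = init i by move=> ir; rewrite /= bRE /GR ir.
have b_left n : b (r%:Z - 1 - n%:Z) = bL n.
  have [nr|rn] := ltnP n r.
    have -> : r%:Z - 1 - n%:Z = (r.-1 - n)%N by lia.
    by rewrite b_init ?bLE /GL ?nr //; lia.
  rewrite (_ : r%:Z - 1 - n%:Z = Negz (n - r)%N); last by lia.
  by rewrite /= subnK.
exists b => //; split=> [[n|n]|]; [exact: bRL | exact: bLL |].
move=> [n|n] m.
  rewrite big_ord_recr /= bRE /GR ltnNge leq_addl /= addnK.
  rewrite (divLP _ _).2 ?subrr //; first exact: exN0.
  by apply/is_laurent_opp/is_laurent_sum => i _; apply/is_laurent_pmulL/bRL.
have nE i : (i <= r)%N -> b (Negz n + i%:Z) = bL (n + r - i)%N.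
  by move=> ir; rewrite -b_left; congr b; lia.
have kE : Negz n = r%:Z - 1 - (n + r)%N%:Z by lia.
rewrite big_ord_recl nE // subn0 bLE /GL ltnNge leq_addl /= -kE.
rewrite (divLP _ _).2 ?exN0 //.
  rewrite -[X in _ + X]opprK -opprD; apply/eqP; rewrite oppr_eq0 subr_eq0; apply/eqP.
  apply: eq_bigr => i _; rewrite nE /bump /= ?add1n //.
by apply/is_laurent_opp/is_laurent_sum => i _; apply/is_laurent_pmulL/bLL.
Qed.

Lemma pmulL_at0 (p : {poly K}) y : nu_ge y 0 -> pmulL p y 0 = p.[0] * y 0.
Proof.
move=> y0; rewrite (@pmulL_widen _ (size p).+1) // big_ord_recl big1 => [|j _].
  by rewrite addr0 horner_coef0 subr0.
by rewrite y0 ?mulr0 //= /bump /=; lia.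
Qed.

Lemma integral_at_standard alpha f : l 0%N != 0 -> l r != 0 ->
  (forall k : nat, ev (l 0%N) (alpha - k.+1%:R) != 0) ->
  (forall k : nat, ev (l r) (alpha - k.+1%:R) != 0) ->
  integral_at l iota f alpha <-> in_loc_span iota alpha 1%:M f.
Proof.
move=> l0N0 lrN0 l0 lr; split; last first.
  apply: integral_at_span => i.
  have -> : row i 1%:M = (1%:F)^-1 *: map_mx (@tofrac _) (delta_mx 0 i) :> 'rV[F]_r.
    by rewrite tofrac1 invr1 scale1r map_delta_mx rowE mulmx1.
  apply/integral_atP; first exact: oner_neq0.
  move=> b bsol y yL E m mb.
  have one n (z : int -> K) : pmulL (expand iota 1 alpha) z n = z n.
    by rewrite /expand rmorph1 comp_polyC pmulLC mul1r.
  move=> n nm; rewrite -one E /actL (bigD1 i) //= big1 ?addr0 => [|j ji].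
    by rewrite mxE !eqxx one; apply: (sol_nu_ge_right bsol lr mb).
  by rewrite mxE (negPf ji) andbF /expand rmorph0 comp_poly0 -polyC0 pmulLC mul0r.
have [u [a [uN0 ->]]] := row_common_denominator f.
rewrite integral_atP // => intf; apply/in_loc_span1 => i0.
(* The test solution has value 1 at [i0] and 0 elsewhere in the window, so that (f . b)(alpha) is
   the expansion of coordinate [i0] of f. *)
pose one (n : int) : K := (n == 0)%:R.
have one0 : nu_ge one 0 by move=> n n0; rewrite /one lt_eqF.
pose init (j : nat) (n : int) : K := (j == i0)%:R * one n.
have initL j : is_laurent (init j).
  by exists 0 => n n0; rewrite /init one0 ?mulr0.
have [b bsol b_init] := sol_exists alpha l0N0 lrN0 initL.
have bm : liminf_nu_ge (fun n => b (- n%:Z)) 0.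
  have left : forall n : nat, nu_ge (b (r%:Z - 1 - n%:Z)) 0.
    apply: (sol_nu_ge_left bsol l0) => j jr n n0.
    by rewrite b_init // /init one0 ?mulr0.
  exists 0%N => n _; have := left (r.-1 + n)%N; congr nu_ge; congr b.
  by have := ltn_ord i0; lia.
have uE : expand iota u alpha != 0 by rewrite expand_eq0.
have [yL yE] := divLP uE (is_laurent_actL a bsol).
set y := divL _ _ in yL yE.
have y0 : nu_ge y 0 := intf b bsol y yL yE 0 bm.
have aE : actL iota a alpha b =1 pmulL (expand iota (a 0 i0) alpha) one.
  move=> n; rewrite /actL (bigD1 i0) //= big1 ?addr0 => [|j ji].
    by rewrite b_init //; apply: eq_pmulL => k; rewrite /init eqxx mul1r.
  rewrite b_init // /pmulL big1 // => k _.
  by rewrite /init (_ : (j : nat) == i0 = false) ?mul0r ?mulr0 //; apply/negbTE.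
rewrite !mxE mulrC; have [p [q [qN0 cop pqE]]] := coprime_frac ((a 0 i0)%:F / u%:F).
have auE := eq_frac uN0 qN0 pqE; rewrite pqE; apply: loc_ring_frac.
have qy : pmulL (expand iota q alpha) y =1 pmulL (expand iota p alpha) one.
  apply: (pmulL_inj uE); first exact: is_laurent_pmulL.
    by apply: is_laurent_pmulL; exists 0.
  move=> n; rewrite -pmulLA [_ * expand iota q alpha]mulrC pmulLA.
  by rewrite (eq_pmulL _ yE) (eq_pmulL _ aE) -!pmulLA -!expandM mulrC auE mulrC.
(* Constant terms of q y = p: a zero of [q] at [alpha] would also be a zero of [p], against
   coprimality. *)
have := qy 0; rewrite !pmulL_at0 // /one eqxx mulr1 !expand0 => qpE.
apply/negP=> /eqP q0; move: qpE; rewrite q0 mul0r => /esym p0.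
have : coprimep (map_poly iota p) (map_poly iota q) by rewrite coprimep_map.
move/coprimep_root => /(_ alpha); rewrite rootE p0 q0 !eqxx.
by move/(_ isT).
Qed.

End IntegralModule.

(** * Lattices spanned by a suitable basis *)

Section Lattices.
Variables (C : fieldType) (K : closedFieldType) (iota : {rmorphism C -> K}).
Notation F := {fraction {poly C}}.
Notation ev p alpha := (map_poly iota p).[alpha].
Variables (r : nat) (l : nat -> {poly C}).
Implicit Types (f : 'rV[F]_r) (alpha gamma : K).

Lemma in_loc_spanD alpha (W : 'M[F]_r) f f' : in_loc_span iota alpha W f ->
  in_loc_span iota alpha W f' -> in_loc_span iota alpha W (f + f').
Proof.
move=> [lam [Olam ->]] [mu [Omu ->]]; exists (lam + mu); rewrite mulmxDl.
by split=> // i; rewrite mxE; apply: loc_ringD.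
Qed.

Lemma in_loc_spanB alpha (W : 'M[F]_r) f f' : in_loc_span iota alpha W f ->
  in_loc_span iota alpha W f' -> in_loc_span iota alpha W (f - f').
Proof.
move=> [lam [Olam ->]] [mu [Omu ->]]; exists (lam - mu); rewrite mulmxBl.
by split=> // i; rewrite !mxE; apply: loc_ringB.
Qed.

(** Coordinate 0 of S f comes from S^r alone. As [l 0] and [l r] are units at [alpha], it yields the
    last coordinate of f, and subtracting its contribution yields the others. *)
Lemma shiftA_standard alpha f :
  ev (l 0%N) alpha != 0 -> ev (l r) alpha != 0 ->
  in_loc_span iota alpha 1%:M (shiftA l f) <-> in_loc_span iota (alpha + 1) 1%:M f.
Proof.
move=> l0 lr; rewrite !in_loc_span1; split=> O i.
  apply/loc_ring_sigmaF.
  have r_gt0 : (0 < r)%N by apply: leq_ltn_trans (ltn_ord i).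
  have Olast (k : 'I_r) : k.+1 = r -> loc_ring iota alpha (sigmaF (f 0 k)).
    move=> kr; have := O (Ordinal r_gt0); rewrite mxE big_pred0 //.
    rewrite (big_pred1 k) => [|k']; last first.
      by apply/eqP/eqP => [E|->//]; apply: val_inj => /=; lia.
    rewrite sub0r /= => O0.
    have lrF : (l r)%:F != 0 :> F by rewrite tofrac_eq0 (ev_neq0 lr).
    have l0F : (l 0%N)%:F != 0 :> F by rewrite tofrac_eq0 (ev_neq0 l0).
    have := loc_ringM (loc_ring_frac (l r) l0) (loc_ringB (loc_ring0 iota alpha) O0).
    have aux (G : fieldType) (x y s : G) : x != 0 -> y != 0 ->
        x / y * (0 - - (s * (y / x))) = s.
      move=> x0 y0; rewrite sub0r opprK mulrC -mulrA mulf_div [y * x]mulrC.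
      by rewrite divff ?mulr1 // mulf_neq0.
    by rewrite (aux _ _ _ _ lrF l0F).
  have [ir|ir] := eqVneq i.+1 r; first exact: Olast.
  have lt_ir : (i.+1 < r)%N by rewrite ltn_neqAle ir ltn_ord.
  have := O (Ordinal lt_ir); rewrite mxE (big_pred1 i) => [Oi|k]; last first.
    by rewrite /= -val_eqE /= eqSS.
  have Os : loc_ring iota alpha (\sum_(k < r | k.+1 == r)
      sigmaF (f 0 k) * ((l i.+1)%:F / (l r)%:F)).
    apply: loc_ring_sum => k /eqP kr.
    by apply: loc_ringM; [apply: Olast | apply: loc_ring_frac].
  by have := loc_ringD Oi Os; rewrite subrK.
rewrite mxE; apply: loc_ringB; apply: loc_ring_sum => k _.
  exact/loc_ring_sigmaF.
by apply: loc_ringM; [apply/loc_ring_sigmaF | apply: loc_ring_frac].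
Qed.

Lemma le_orb_same alpha beta : le_orb alpha beta -> same_orbit alpha beta.
Proof.
case=> [->|[k E]]; first by exists 0; rewrite subrr.
by exists (- k.+1%:Z); rewrite E rmorphN.
Qed.

Lemma lt_orb_succ alpha beta : lt_orb alpha beta <-> le_orb (alpha + 1) beta.
Proof.
split=> [[k E]|].
  case: k E => [|k] E; [left | right; exists k].
    by apply/eqP; rewrite -subr_eq0 addrAC E addNr.
  by rewrite addrAC E -[k.+2]addn1 natrD opprD -addrA addNr addr0.
case=> [<-|[k E]]; first by exists 0%N; rewrite opprD addrA subrr sub0r.
exists k.+1; rewrite -[k.+2]addn1 natrD opprD -E.
by rewrite [alpha + 1 - _]addrAC addrK.
Qed.

Lemma is_root0rN alpha :
  ~ is_root0r r l iota alpha <-> ev (l 0%N) alpha != 0 /\ ev (l r) alpha != 0.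
Proof.
rewrite /is_root0r rmorphM rootM /root; split=> [/negP|[l0 lr]].
  by rewrite negb_or => /andP.
by rewrite (negPf l0) (negPf lr).
Qed.

Variables (betas : seq K) (W : 'M[F]_r).
Hypotheses (l0N0 : l 0%N != 0) (lrN0 : l r != 0).
Hypotheses (Hbetas : admissible_betas r l iota betas).
Hypothesis (HW : suitable l iota betas W).

Lemma suitable_integral alpha beta f : beta \in betas -> le_orb alpha beta ->
  in_loc_span iota alpha W f <-> integral_at l iota f alpha.
Proof.
move=> bB le_ab; case: HW => uW WZ WnZ.
have [aZ|anZ] := classic (inZ r l iota betas alpha).
  have [_ Wint Wspan] := WZ _ aZ.
  by split=> [|/Wspan //]; apply: integral_at_span.
(* A root strictly left of [alpha] would put [alpha], which is at most [beta], into Z. *)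
have noroot (k : nat) :
    ev (l 0%N) (alpha - k.+1%:R) != 0 /\ ev (l r) (alpha - k.+1%:R) != 0.
  apply/is_root0rN => rt; apply: anZ; exists beta => //.
  split=> //; first exact: le_orb_same.
  by exists (alpha - k.+1%:R); split=> //; exists k; rewrite addrAC subrr sub0r.
rewrite -(WnZ _ anZ) (integral_at_standard f l0N0 lrN0) // => k;
  by case: (noroot k).
Qed.

(** If [gamma] is strictly left of some beta, then [gamma] and [gamma + 1] are both at most beta and
    both lattices consist of the integral elements. Otherwise [gamma] is not a root of l_0 l_r,
    since roots are at most their beta, and both points lie outside Z, where the lattice is
    standard. *)
Lemma shiftA_suitable gamma f : gamma \notin betas ->
  in_loc_span iota gamma W (shiftA l f) <-> in_loc_span iota (gamma + 1) W f.
Proof.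
move=> gB.
have [[beta bB lt_gb]|nlt] := classic (exists2 beta, beta \in betas & lt_orb gamma beta).
  have le_gb1 := (lt_orb_succ _ _).1 lt_gb; have le_gb : le_orb gamma beta by right.
  rewrite (suitable_integral _ bB le_gb) (suitable_integral _ bB le_gb1).
  exact: integral_at_shiftA.
have le_gB beta : beta \in betas -> ~ le_orb gamma beta.
  move=> bB [gE|lt_gb]; last by apply: nlt; exists beta.
  by move: gB; rewrite gE bB.
case: HW => uW _ WnZ; rewrite -!WnZ.
- have [l0g lrg] : ev (l 0%N) gamma != 0 /\ ev (l r) gamma != 0.
    apply/is_root0rN => rt; case: Hbetas => _ _ /(_ _ rt)[beta bB sgb] /(_ beta gamma bB rt sgb).
    by move=> le_gb _; apply: le_gB le_gb.
  exact: shiftA_standard.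
- by case=> beta bB [_ /lt_orb_succ lt_gb _]; apply: nlt; exists beta.
- by case=> beta bB [_ le_gb _]; apply: le_gB le_gb.
Qed.

End Lattices.

(** * Zeros and propagation along an orbit *)

Section Orbits.
Variable K : closedFieldType.
Hypothesis charK : [pchar K] =i pred0.

Lemma intr_eq0_pchar0 (k : int) : (k%:~R == 0 :> K) = (k == 0).
Proof.
have natr_eq0 := (pcharf0P K).1 charK.
by case: k => n; rewrite ?NegzE ?rmorphN ?oppr_eq0 /= natr_eq0.
Qed.

(** In characteristic zero the points [gamma + k] are distinct, so each entry of [s] is hit at most
    once. *)
Lemma orbit_bounded (gamma : K) (s : seq K) :
  exists N : nat, forall k : int, gamma + k%:~R \in s -> (`|k| <= N)%N.
Proof.
elim: s => [|x s [N IH]]; first by exists 0%N.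
have [[k0 k0E]|nk] := classic (exists k : int, gamma + k%:~R = x).
  exists (maxn `|k0| N) => k; rewrite inE => /orP[/eqP kE|/IH]; last by lia.
  suff -> : k = k0 by lia.
  apply/eqP; rewrite -subr_eq0 -intr_eq0_pchar0 rmorphB /= subr_eq0.
  by apply/eqP/(addrI gamma); rewrite kE.
exists N => k; rewrite inE => /orP[/eqP kE|/IH//].
by case: nk; exists k.
Qed.

Lemma orbit_roots_bounded (p : {poly K}) (gamma : K) : p != 0 ->
  exists N : nat, forall k : int, root p (gamma + k%:~R) -> (`|k| <= N)%N.
Proof.
have [s ->] := closed_field_poly_normal p.
rewrite scaler_eq0 lead_coef_eq0 => /norP[pN0 _].
have [N bN] := orbit_bounded gamma s; exists N => k.
by rewrite rootZ ?lead_coef_eq0 // root_prod_XsubC => /bN.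
Qed.

Lemma shift_free_orbit (p : {poly K}) (gamma : K) : shift_free p ->
  exists s : int, forall k : int, root p (gamma + k%:~R) -> k = s.
Proof.
move=> sfp.
have [[s rs]|ns] := classic (exists s : int, root p (gamma + s%:~R)); last first.
  (* On an orbit without roots any value of [s] will do. *)
  by exists 0 => k rk; case: ns; exists k.
exists s => k rk; apply/eqP; rewrite -subr_eq0; apply/negPn/negP => ks.
have /coprimep_root/(_ rs) := sfp _ ks.
rewrite horner_comp !hornerE rmorphB /= -addrA [s%:~R + _]addrC subrK.
by move/eqP: rk => ->; rewrite eqxx.
Qed.

(** The chain can break only between [s] and [s + 1]: points right of [s] are reached from the far
    right, [s] itself and the points left of it from the far left. *)
Lemma orbit_propagation (P : int -> Prop) (s : int) (N : nat) :
  (forall k, (N < `|k|)%N -> P k) -> (forall k, k != s -> P k <-> P (k + 1)) ->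
  forall k, P k.
Proof.
move=> Pfar Pstep k; have [sk|ks] := ltrP s k.
  have Pright n : forall k, s < k -> P (k + n%:Z) -> P k.
    elim: n => [|n IH] j sj; first by rewrite addr0.
    move=> Pj; apply/Pstep; first by rewrite gt_eqF.
    by apply: IH; [lia | move: Pj; congr P; lia].
  by apply: (Pright (N + `|k|).+1%N) => //; apply: Pfar; lia.
have Pleft n : forall k, k <= s -> P (k - n%:Z) -> P k.
  elim: n => [|n IH] j js; first by rewrite subr0.
  have jS : j - 1 != s by apply/eqP; lia.
  move=> Pj; have [+ _] := Pstep _ jS; rewrite subrK; apply.
  by apply: IH; [lia | move: Pj; congr P; lia].
by apply: (Pleft (N + `|k|).+1%N) => //; apply: Pfar; lia.
Qed.

End Orbits.

(** * Denominators and the conclusion *)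

Lemma dvdp_of_dvdp_mul_gcd (C : fieldType) r (u e : {poly C}) (c : 'I_r -> {poly C}) :
  gcdp u (\big[@gcdp C/0]_(i < r) c i) %= 1 -> (forall i, u %| e * c i) -> u %| e.
Proof.
rewrite gcdp_eqp1 => cop ue.
have : u %| e * \big[@gcdp C/0]_(i < r) c i.
  apply: (big_ind (fun x => u %| e * x)); first by rewrite mulr0 dvdp0.
    by move=> x y ux uy; rewrite (eqp_dvdr _ (mulp_gcdr x y e)) dvdp_gcd ux.
  by move=> i _; apply: ue.
by rewrite Gauss_dvdpl.
Qed.

(** Comparing coordinates with respect to [W] gives e c = ut (sigma(b) M - e b). *)
Lemma deltaA_denominator (C : fieldType) r (l : nat -> {poly C})
    (W : 'M[{fraction {poly C}}]_r) (e ut : {poly C}) (M : 'M[{poly C}]_r)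
    (b c : 'rV[{poly C}]_r) :
  W \in unitmx -> e != 0 -> ut != 0 ->
  shiftW l W = (e%:F)^-1 *: (map_mx (@tofrac _) M *m W) ->
  (ut%:F)^-1 *: (map_mx (@tofrac _) c *m W) =
    deltaA l (map_mx (@tofrac _) b *m W) ->
  forall i, ut %| e * c 0 i.
Proof.
move=> uW eN0 utN0 SW; rewrite /deltaA shiftA_mul SW -scalemxAr mulmxA.
have -> : map_mx (@sigmaF C) (map_mx (@tofrac _) b) =
    map_mx (@tofrac _) (map_mx (shiftp 1) b).
  by apply/rowP=> j; rewrite !mxE sigmaF_tofrac.
rewrite -map_mxM !scalemxAl -mulmxBl => /(can_inj (mulmxK uW)) /rowP E i.
have {E} := E i; rewrite mxE [X in _ * X]mxE [X in _ = X]mxE [X in X + _]mxE.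
rewrite [X in _ * X + _]mxE [X in _ + X]mxE [X in - X]mxE => E.
apply/dvdpP; exists ((map_mx (shiftp 1) b *m M) 0 i - e * b 0 i).
apply/eqP; rewrite -tofrac_eq !tofracM tofracB tofracM; move: E.
have aux (G : fieldType) (u x y z v : G) : u != 0 -> x != 0 ->
    u^-1 * y = x^-1 * z - v -> x * y == (z - x * v) * u.
  move=> uN0 xN0 E; have -> : y = u * (x^-1 * z - v) by rewrite -E mulVKf.
  by apply/eqP; field.
by apply: aux; rewrite tofrac_eq0.
Qed.

Theorem mainTheorem9 (C : fieldType) (charC : [pchar C] =i pred0)
    (K : closedFieldType) (iota : {rmorphism C -> K})
    (Kalg : forall z : K, exists2 p : {poly C}, p != 0 & root (map_poly iota p) z)
    (r : nat) (l : nat -> {poly C}) (l0 : l 0%N != 0) (lr : l r != 0)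
    (betas : seq K) (Hbetas : admissible_betas r l iota betas)
    (W : 'M[{fraction {poly C}}]_r) (HW : suitable l iota betas W)
    (e : {poly C}) (M : 'M[{poly C}]_r)
    (HSW : shiftW l W = ((e%:F)^-1 *: (map_mx (@tofrac _) M *m W)))
    (c : 'rV[{poly C}]_r) (ut : {poly C})
    (Hgcd : gcdp ut (\big[@gcdp C/0]_(i < r) c 0 i) %= 1)
    (Hsf : shift_free (map_poly iota ut * \prod_(beta <- betas) ('X - beta%:P)))
    (Hsum : summable l ((ut%:F)^-1 *: (map_mx (@tofrac _) c *m W))) :
  (ut %| e) /\
  exists b : 'rV[{poly C}]_r,
    (ut%:F)^-1 *: (map_mx (@tofrac _) c *m W) = deltaA l (map_mx (@tofrac _) b *m W).
Proof.
have uW : W \in unitmx by case: HW.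
have charK : [pchar K] =i pred0 by move=> p; rewrite (fmorph_pchar iota) charC.
have utN0 : ut != 0.
  (* The zero polynomial is not coprime to its shifts, hence not shift-free. *)
  apply/negP=> /eqP ut0; have := Hsf 1 isT.
  by rewrite ut0 rmorph0 mul0r comp_poly0 /coprimep gcd0p size_poly0.
case: Hsum => g hE.
pose good alpha := in_loc_span iota alpha W g.
have step alpha : ~~ root (map_poly iota ut * \prod_(beta <- betas) ('X - beta%:P)) alpha ->
    good alpha <-> good (alpha + 1).
  rewrite rootM root_prod_XsubC negb_or => /andP[ut_a aB].
  (* [ut] does not vanish at [alpha], so h lies in the lattice there, and adding or subtracting it
     passes between g and S g. *)
  have hO : in_loc_span iota alpha W (deltaA l g).
    rewrite -hE; exists ((ut%:F)^-1 *: map_mx (@tofrac _) c); rewrite scalemxAl.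
    by split=> // i; rewrite !mxE mulrC; apply: loc_ring_frac.
  rewrite /good -(shiftA_suitable l0 lr Hbetas HW _ aB); split=> O.
    by rewrite -[shiftA l g](subrK g); apply: in_loc_spanD.
  by have := in_loc_spanB O hO; rewrite /deltaA subKr.
have good_all alpha : good alpha.
  (* The roots of the common denominator [d] of the coordinates of g are bounded on the orbit, so
     all points far out are good. *)
  have [d [a [dN0 gE]]] := row_common_denominator (g *m invmx W).
  have dKN0 : map_poly iota d != 0 by rewrite map_poly_eq0.
  have [N bN] := orbit_roots_bounded charK alpha dKN0.
  have [s sU] := shift_free_orbit alpha Hsf.
  suff H : forall k : int, good (alpha + k%:~R) by have := H 0; rewrite addr0.
  apply: (orbit_propagation (s := s) (N := N)) => k.
    rewrite ltnNge => kN; apply/in_loc_span_unitmx => // i; rewrite gE !mxE mulrC.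
    by apply: loc_ring_frac; apply: contra kN => dk; apply: bN.
  move=> ks; rewrite rmorphD /= addrA; apply: step.
  by apply: contra_neqN ks => /sU.
have : forall i, exists p, (g *m invmx W) 0 i = p%:F.
  move=> i; apply: (loc_ring_everywhere (iota := iota)) => alpha.
  by have /in_loc_span_unitmx -/(_ uW i) := good_all alpha.
move=> /fin_all_exists[b bE].
have gE : g = map_mx (@tofrac _) (\row_i b i) *m W.
  rewrite -[LHS](mulmxKV uW); congr (_ *m _).
  by apply/rowP=> i; rewrite bE !mxE.
split; last by exists (\row_i b i); rewrite -gE.
(* [deltaA_denominator] asks for a nonzero [e]; every polynomial divides 0. *)
have [->|eN0] := eqVneq e 0; first exact: dvdp0.
apply: (dvdp_of_dvdp_mul_gcd Hgcd); apply: (deltaA_denominator uW eN0 utN0 HSW).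
by rewrite hE gE.
Qed.
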